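(* Let $f$ be holomorphic on the open disc $\Delta(0,R)$ with power series $f(z)=a_0+a_2z^2+a_3z^3+\sum_{n\ge4}a_nz^n$, where $a_0,a_2,a_3$ are real with $a_0>0$, $a_2>0$, $a_3<0$. Let $(f_n)$ be a sequence of holomorphic functions on $\Delta(0,R)$ converging to $f$ uniformly on compact subsets of $\Delta(0,R)$. Then there exist $n_0$ and a sequence of complex numbers $(b_n)$ such that for $n\ge n_0$, $b_n$ is a turning point of $f_n$, and $\lim_n b_n=0$.
   Context: A turning point of a holomorphic function $g$ is a point $z$ of its domain with $\mathrm{Im}\, g(z)=0$ and $\mathrm{Re}\, g'(z)=0$. *)

(* Defs.v *)
From Stdlib Require Export Reals List.
From Coquelicot Require Export Coquelicot.

Open Scope R_scope.

Definition disc (c : C) (r : R) (z : C) : Prop := Cmod (z - c)%C < r.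

(* Functions on a domain are represented by total functions C -> C whose values
   off the domain are irrelevant; [D] is always an open set here, so complex
   differentiability at a point of [D] only depends on the values in [D]. *)
Definition holomorphic_on (D : C -> Prop) (g : C -> C) : Prop :=
  forall z : C, D z -> @ex_derive C_AbsRing C_NormedModule g z.

Definition compact_set (K : C -> Prop) : Prop :=
  forall (I : Type) (U : I -> C -> Prop),
    (forall i : I, @open C_UniformSpace (U i)) ->
    (forall z : C, K z -> exists i : I, U i z) ->
    exists l : list I, forall z : C, K z -> exists i : I, In i l /\ U i z.

Definition cvg_unif_on (K : C -> Prop) (fn : nat -> C -> C) (f : C -> C) : Prop :=
  forall eps : R, 0 < eps ->
    exists N : nat, forall n : nat, (N <= n)%nat ->
      forall z : C, K z -> Cmod (fn n z - f z)%C < eps.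

Definition cvg_unif_on_compacts (D : C -> Prop) (fn : nat -> C -> C) (f : C -> C)
  : Prop :=
  forall K : C -> Prop,
    compact_set K -> (forall z : C, K z -> D z) -> cvg_unif_on K fn f.

(* [C_derive] is a total operator; it is the complex derivative wherever that
   derivative exists, in particular on [D] when [g] is holomorphic on [D]. *)
Definition turning_point (D : C -> Prop) (g : C -> C) (z : C) : Prop :=
  D z /\ Im (g z) = 0 /\ Re (C_derive g z) = 0.

(* Main.v *)
Require Import Defs.
From Stdlib Require Import Lra Lia Psatz Ranalysis5 Classical ClassicalEpsilon.

(** Write [f_n = u + i v]. By the Cauchy-Riemann equations [Re f_n' = v_y], so a
    turning point is a point of the real curve [v = 0] with vertical tangent. On
    a small square of half-side [d] the limit satisfies
    [v = 2 a2 x y + a3 (3 x^2 y - y^3) + O(d^4)] and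
    [v_y = 2 a2 x + 3 a3 (x^2 - y^2) + O(d^3)], and these estimates pass to [f_n]
    for large [n]: the derivative is controlled by Cauchy's estimate, obtained
    from Goursat's lemma in logarithmic coordinates. Hence there is a zero of [v]
    with [v_y < 0] on the left side of the square, whereas no zero of [v] with
    [v_y <= 0] lies on the other three sides. The rightmost zero with [v_y <= 0]
    must then have [v_y = 0], since otherwise it could be moved to the right. *)

(** The system [Im g = 0], [Re g' = 0] is not holomorphic in [z], so Hurwitz's theorem does not
    apply to it; and the gradient of [v] vanishes at 0 for the limit, so the implicit function
    theorem does not apply either. The quadratic term alone decides nothing: every point of the
    imaginary axis is a turning point of [a2 z^2]. The cubic term decides. For the cubic model
    [v = y v_y + 2 a3 y^3], so with [a3 < 0] a point with [v_y <= 0] and [y <> 0] has [y v < 0].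
    Near 0 the zeros of the model with [v_y <= 0] are therefore the real points [x <= 0], a branch
    that enters through the left side and ends at 0. Holomorphy is mere complex differentiability,
    so even the continuity of [v_y] has to be proved; this is why Goursat's bisection is needed.
    Logarithmic coordinates turn an annulus into a rectangle, so that the lemma for rectangles is
    enough. *)

(** * Nested intervals and bisection of rectangles *)

Lemma nested_intervals (lo hi : nat -> R) :
  (forall n, lo n <= lo (S n)) -> (forall n, hi (S n) <= hi n) ->
  (forall n, lo n <= hi n) ->
  exists x, forall n, lo n <= x <= hi n.
Proof.
intros Hlo Hhi Hle.
assert (mlo : forall n k, lo n <= lo (n + k)%nat).
{ intros n k; induction k as [|k IH].
  - rewrite Nat.add_0_r; lra.
  - rewrite Nat.add_succ_r; specialize (Hlo (n + k)%nat); lra. }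
assert (mhi : forall n k, hi (n + k)%nat <= hi n).
{ intros n k; induction k as [|k IH].
  - rewrite Nat.add_0_r; lra.
  - rewrite Nat.add_succ_r; specialize (Hhi (n + k)%nat); lra. }
assert (cross : forall n m, lo n <= hi m).
{ intros n m; specialize (mlo n m); specialize (mhi m n).
  specialize (Hle (n + m)%nat); rewrite (Nat.add_comm m n) in mhi; lra. }
destruct (completeness (fun y => exists n, y = lo n)) as [x [ub lub]].
- exists (hi O); intros y [n ->]; apply cross.
- exists (lo O), O; reflexivity.
- exists x; intros n; split.
  + apply ub; now exists n.
  + apply lub; intros y [m ->]; apply cross.
Qed.

Lemma div_pow2_small (L d : R) : 0 < d -> exists n, L / 2 ^ n < d.
Proof.
intros Hd.
destruct (Rle_lt_dec L 0) as [HL|HL].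
- exists O; simpl; lra.
- destruct (Pow_x_infinity 2) with (b := L / d + 1) as [n Hn].
  + rewrite Rabs_pos_eq; lra.
  + exists n. specialize (Hn n (le_n n)).
    assert (0 < 2 ^ n) by (apply pow_lt; lra).
    rewrite Rabs_pos_eq in Hn by lra.
    apply Rmult_lt_reg_r with (2 ^ n); [assumption|].
    unfold Rdiv at 1; rewrite Rmult_assoc, Rinv_l, Rmult_1_r by lra.
    apply Rmult_lt_reg_l with (/ d); [now apply Rinv_0_lt_compat|].
    rewrite <- Rmult_assoc, Rinv_l by lra. unfold Rdiv in Hn; lra.
Qed.

(** Common engine of three compactness arguments: Goursat's lemma, the finite subcover property of
    [box], and the accumulation point in [vertical_tangency]. [B] is a badness that some quarter
    always inherits. Degenerate rectangles are allowed because the last use bisects a vertical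
    segment. *)
Lemma rectangle_bisection (B : R -> R -> R -> R -> Prop) (a b c d : R) :
  a <= b -> c <= d ->
  (forall a b c d, a <= b -> c <= d -> B a b c d ->
     let m := (a + b) / 2 in let k := (c + d) / 2 in
     B a m c k \/ B m b c k \/ B a m k d \/ B m b k d) ->
  B a b c d ->
  exists x y, a <= x <= b /\ c <= y <= d /\
  forall e, 0 < e -> exists a' b' c' d',
    a <= a' /\ a' <= x <= b' /\ b' <= b /\ c <= c' /\ c' <= y <= d' /\ d' <= d /\
    b' - a' < e /\ d' - c' < e /\ B a' b' c' d'.
Proof.
intros Hab Hcd Hstep H0.
pose (T := (R * R * R * R)%type).
pose (BT := fun t : T => let '(a, b, c, d) := t in B a b c d).
pose (ok := fun t : T => let '(a, b, c, d) := t in a <= b /\ c <= d).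
pose (half := fun s t : T =>
  let '(a, b, c, d) := s in let '(a', b', c', d') := t in
  a <= a' /\ b' <= b /\ c <= c' /\ d' <= d /\
  b' - a' = (b - a) / 2 /\ d' - c' = (d - c) / 2).
(* [ok s] and [BT s] stand under the existential so that choice gives a total map [nx], which can be
   iterated. *)
assert (next : forall s : T, exists t, ok s -> BT s -> ok t /\ BT t /\ half s t).
{ intros [[[a1 b1] c1] d1].
  destruct (classic (ok (a1, b1, c1, d1) /\ BT (a1, b1, c1, d1))) as [[[h1 h2] h3]|n].
  2:{ exists (a1, b1, c1, d1); tauto. }
  destruct (Hstep _ _ _ _ h1 h2 h3) as [h|[h|[h|h]]];
  [exists (a1, (a1 + b1) / 2, c1, (c1 + d1) / 2)
  |exists ((a1 + b1) / 2, b1, c1, (c1 + d1) / 2)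
  |exists (a1, (a1 + b1) / 2, (c1 + d1) / 2, d1)
  |exists ((a1 + b1) / 2, b1, (c1 + d1) / 2, d1)];
  intros _ _; (split; [|split; [exact h|]]); simpl; repeat split; lra. }
pose (nx := fun s => proj1_sig (constructive_indefinite_description _ (next s))).
pose (sq := fun n => Nat.iter n nx (a, b, c, d)).
assert (inv : forall n, ok (sq n) /\ BT (sq n)).
{ induction n as [|n [IH1 IH2]].
  - split; [split|]; assumption.
  - change (sq (S n)) with (nx (sq n)). unfold nx.
    destruct constructive_indefinite_description as [t Ht]; simpl.
    destruct (Ht IH1 IH2) as (? & ? & _); split; assumption. }
assert (hf : forall n, half (sq n) (sq (S n))).
{ intros n; change (sq (S n)) with (nx (sq n)). unfold nx.
  destruct constructive_indefinite_description as [t Ht]; simpl.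
  apply Ht; apply inv. }
pose (pa := fun t : T => let '(a, b, c, d) := t in a).
pose (pb := fun t : T => let '(a, b, c, d) := t in b).
pose (pc := fun t : T => let '(a, b, c, d) := t in c).
pose (pd := fun t : T => let '(a, b, c, d) := t in d).
assert (hf' : forall n, pa (sq n) <= pa (sq (S n)) /\ pb (sq (S n)) <= pb (sq n) /\
  pc (sq n) <= pc (sq (S n)) /\ pd (sq (S n)) <= pd (sq n) /\
  pb (sq (S n)) - pa (sq (S n)) = (pb (sq n) - pa (sq n)) / 2 /\
  pd (sq (S n)) - pc (sq (S n)) = (pd (sq n) - pc (sq n)) / 2).
{ intros n; generalize (hf n).
  destruct (sq n) as [[[? ?] ?] ?], (sq (S n)) as [[[? ?] ?] ?]; simpl; tauto. }
assert (inv' : forall n, pa (sq n) <= pb (sq n) /\ pc (sq n) <= pd (sq n) /\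
  B (pa (sq n)) (pb (sq n)) (pc (sq n)) (pd (sq n))).
{ intros n; generalize (inv n); destruct (sq n) as [[[? ?] ?] ?]; simpl; tauto. }
assert (len : forall n, pb (sq n) - pa (sq n) = (b - a) / 2 ^ n /\
                        pd (sq n) - pc (sq n) = (d - c) / 2 ^ n).
{ induction n as [|n [IH1 IH2]].
  - simpl; lra.
  - destruct (hf' n) as (_ & _ & _ & _ & h1 & h2).
    assert (2 ^ n <> 0) by (apply pow_nonzero; lra).
    rewrite h1, h2, IH1, IH2; simpl; split; field; assumption. }
destruct (nested_intervals (fun n => pa (sq n)) (fun n => pb (sq n)))
  as [x Hx]; try (intros n; first [apply hf'|apply inv']).
destruct (nested_intervals (fun n => pc (sq n)) (fun n => pd (sq n)))
  as [y Hy]; try (intros n; first [apply hf'|apply inv']).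
assert (sub : forall n, a <= pa (sq n) /\ pb (sq n) <= b /\ c <= pc (sq n) /\ pd (sq n) <= d).
{ induction n as [|n IH].
  - simpl; lra.
  - specialize (hf' n); lra. }
exists x, y; split; [exact (Hx O)|split; [exact (Hy O)|]].
intros e He.
destruct (div_pow2_small (b - a) e He) as [n1 Hn1].
destruct (div_pow2_small (d - c) e He) as [n2 Hn2].
assert (mono : forall L n k, 0 <= L -> L / 2 ^ (n + k) <= L / 2 ^ n).
{ intros L n k HL. apply Rmult_le_compat_l; [assumption|].
  apply Rinv_le_contravar; [apply pow_lt; lra|].
  apply Rle_pow; [lra|lia]. }
exists (pa (sq (n1 + n2)%nat)), (pb (sq (n1 + n2)%nat)),
  (pc (sq (n1 + n2)%nat)), (pd (sq (n1 + n2)%nat)).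
destruct (sub (n1 + n2)%nat) as (? & ? & ? & ?).
destruct (len (n1 + n2)%nat) as (l1 & l2).
pose proof (mono (b - a) n1 n2 ltac:(lra)).
pose proof (mono (d - c) n2 n1 ltac:(lra)).
rewrite (Nat.add_comm n2 n1) in *.
pose proof (Hx (n1 + n2)%nat); pose proof (Hy (n1 + n2)%nat).
repeat match goal with |- _ /\ _ => split end; try tauto; try lra.
apply inv'.
Qed.

(** * Goursat's lemma for rectangles *)

(** The counterclockwise integral of the form [P dx + Q dy] around a rectangle. *)
Definition boundary_integral (P Q : R -> R -> R) (a b c d : R) : R :=
  RInt (fun x => P x c) a b + RInt (fun y => Q b y) c d
  - RInt (fun x => P x d) a b - RInt (fun y => Q a y) c d.

Lemma differentiable_pt_lim_continuity_2d (g : R -> R -> R) (x y p q : R) :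
  differentiable_pt_lim g x y p q -> continuity_2d_pt g x y.
Proof.
intros H; apply differentiable_continuity_pt; now exists p, q.
Qed.

Lemma continuity_2d_pt_slice_x (g : R -> R -> R) (x y : R) :
  continuity_2d_pt g x y -> continuous (fun t => g t y) x.
Proof.
intros H. apply continuity_pt_filterlim, continuity_pt_locally.
intros e; destruct (H e) as [d Hd]; exists d; intros t Ht.
apply Hd; [exact Ht|]. rewrite Rminus_eq_0, Rabs_R0; apply d.
Qed.

Lemma continuity_2d_pt_slice_y (g : R -> R -> R) (x y : R) :
  continuity_2d_pt g x y -> continuous (fun t => g x t) y.
Proof.
intros H. apply continuity_pt_filterlim, continuity_pt_locally.
intros e; destruct (H e) as [d Hd]; exists d; intros t Ht.
apply Hd; [|exact Ht]. rewrite Rminus_eq_0, Rabs_R0; apply d.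
Qed.

Lemma ex_RInt_continuous_le (g : R -> R) (a b : R) :
  a <= b -> (forall x, a <= x <= b -> continuous g x) -> ex_RInt g a b.
Proof.
intros Hab H; apply (ex_RInt_continuous (V := R_CompleteNormedModule)).
intros x; rewrite Rmin_left, Rmax_right by assumption; apply H.
Qed.

(** An inner side is shared by two quarters that traverse it in opposite directions, so only the
    outer sides survive. *)
Lemma boundary_integral_quarters (P Q : R -> R -> R) (a m b c k d : R) :
  a <= m <= b -> c <= k <= d ->
  (forall x y, a <= x <= b -> c <= y <= d ->
     continuity_2d_pt P x y /\ continuity_2d_pt Q x y) ->
  boundary_integral P Q a b c d =
  boundary_integral P Q a m c k + boundary_integral P Q m b c k +
  boundary_integral P Q a m k d + boundary_integral P Q m b k d.
Proof.
intros Hm Hk H.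
assert (cx : forall y, c <= y <= d -> RInt (fun x => P x y) a b =
   RInt (fun x => P x y) a m + RInt (fun x => P x y) m b).
{ intros y Hy; symmetry; apply (RInt_Chasles (V := R_CompleteNormedModule));
  apply ex_RInt_continuous_le; try lra;
  intros x Hx; apply continuity_2d_pt_slice_x, H; lra. }
assert (cy : forall x, a <= x <= b -> RInt (fun y => Q x y) c d =
   RInt (fun y => Q x y) c k + RInt (fun y => Q x y) k d).
{ intros x Hx; symmetry; apply (RInt_Chasles (V := R_CompleteNormedModule));
  apply ex_RInt_continuous_le; try lra;
  intros y Hy; apply continuity_2d_pt_slice_y, H; lra. }
unfold boundary_integral; rewrite !cx, !cy by lra; ring.
Qed.

(* The affine part of a closed form contributes nothing to the boundary integral. *)
Lemma boundary_integral_affine_error (P Q : R -> R -> R) (a b c d x0 y0 p1 p2 q2 E : R) :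
  a <= b -> c <= d ->
  (forall x y, a <= x <= b -> c <= y <= d ->
     continuity_2d_pt P x y /\ continuity_2d_pt Q x y) ->
  (forall x y, a <= x <= b -> c <= y <= d ->
     Rabs (P x y - P x0 y0 - (p1 * (x - x0) + p2 * (y - y0))) <= E /\
     Rabs (Q x y - Q x0 y0 - (p2 * (x - x0) + q2 * (y - y0))) <= E) ->
  Rabs (boundary_integral P Q a b c d) <= 2 * E * ((b - a) + (d - c)).
Proof.
intros Hab Hcd Hc HE.
assert (iP : forall y, c <= y <= d -> ex_RInt (fun x => P x y) a b).
{ intros y Hy; apply ex_RInt_continuous_le; try lra;
  intros x Hx; apply continuity_2d_pt_slice_x, Hc; lra. }
assert (iQ : forall x, a <= x <= b -> ex_RInt (fun y => Q x y) c d).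
{ intros x Hx; apply ex_RInt_continuous_le; try lra;
  intros y Hy; apply continuity_2d_pt_slice_y, Hc; lra. }
assert (lin : forall A B s t, is_RInt (fun x => A + B * x) s t
   ((A * t + B * t * t / 2) - (A * s + B * s * s / 2))).
{ intros A B s t.
  apply (is_RInt_derive (V := R_CompleteNormedModule) (fun x => A * x + B * x * x / 2)).
  - intros x _; auto_derive; [easy|field].
  - intros x _; apply (ex_derive_continuous (fun x => A + B * x)); auto_derive; easy. }
assert (err : forall g A B s t, s <= t -> ex_RInt g s t ->
   (forall x, s <= x <= t -> Rabs (g x - (A + B * x)) <= E) ->
   Rabs (RInt g s t - ((A * t + B * t * t / 2) - (A * s + B * s * s / 2))) <= (t - s) * E).
{ intros g A B s t Hst Hg Hb.
  rewrite <- (is_RInt_unique _ _ _ _ (lin A B s t)).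
  pose proof (ex_intro _ _ (lin A B s t) : ex_RInt (fun x => A + B * x) s t) as Hl.
  assert (Hm := RInt_minus (V := R_CompleteNormedModule) g (fun x => A + B * x) s t Hg Hl).
  change (RInt g s t - RInt (fun x => A + B * x) s t)
    with (minus (RInt g s t) (RInt (fun x => A + B * x) s t)); rewrite <- Hm.
  apply abs_RInt_le_const; [assumption| |exact Hb].
  now apply (ex_RInt_minus (V := R_NormedModule)). }
pose proof (err (fun x => P x c) (P x0 y0 - p1 * x0 + p2 * (c - y0)) p1 a b Hab (iP c ltac:(lra))) as e1.
pose proof (err (fun x => P x d) (P x0 y0 - p1 * x0 + p2 * (d - y0)) p1 a b Hab (iP d ltac:(lra))) as e2.
pose proof (err (fun y => Q a y) (Q x0 y0 - q2 * y0 + p2 * (a - x0)) q2 c d Hcd (iQ a ltac:(lra))) as e3.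
pose proof (err (fun y => Q b y) (Q x0 y0 - q2 * y0 + p2 * (b - x0)) q2 c d Hcd (iQ b ltac:(lra))) as e4.
lapply e1; clear e1; [intros e1|].
2:{ intros x Hx; destruct (HE x c Hx ltac:(lra)) as [h _]; eapply Rle_trans; [|exact h].
    apply Req_le; f_equal; ring. }
lapply e2; clear e2; [intros e2|].
2:{ intros x Hx; destruct (HE x d Hx ltac:(lra)) as [h _]; eapply Rle_trans; [|exact h].
    apply Req_le; f_equal; ring. }
lapply e3; clear e3; [intros e3|].
2:{ intros x Hx; destruct (HE a x ltac:(lra) Hx) as [_ h]; eapply Rle_trans; [|exact h].
    apply Req_le; f_equal; ring. }
lapply e4; clear e4; [intros e4|].
2:{ intros x Hx; destruct (HE b x ltac:(lra) Hx) as [_ h]; eapply Rle_trans; [|exact h].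
    apply Req_le; f_equal; ring. }
unfold boundary_integral.
apply Rabs_le_between in e1, e2, e3, e4.
apply Rabs_le; split; lra.
Qed.

(** The shared [p2] makes the form closed at each point, without continuity of the partial
    derivatives. If the integral were nonzero, bisection would give arbitrarily small rectangles
    whose integral exceeds [k] times the squared semi-perimeter; differentiability at the limit
    point bounds it by half of that. *)
Lemma goursat_rectangle (P Q : R -> R -> R) (a b c d : R) :
  a <= b -> c <= d ->
  (forall x y, a <= x <= b -> c <= y <= d -> exists p1 p2 q2,
     differentiable_pt_lim P x y p1 p2 /\ differentiable_pt_lim Q x y p2 q2) ->
  boundary_integral P Q a b c d = 0.
Proof.
intros Hab Hcd HD.
assert (Hc : forall x y, a <= x <= b -> c <= y <= d ->
     continuity_2d_pt P x y /\ continuity_2d_pt Q x y).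
{ intros x y Hx Hy; destruct (HD x y Hx Hy) as (p1 & p2 & q2 & h1 & h2); split;
  eapply differentiable_pt_lim_continuity_2d; eassumption. }
apply NNPP; intros Hne.
pose (I := Rabs (boundary_integral P Q a b c d)).
assert (HI : 0 < I) by now apply Rabs_pos_lt.
pose (L := (b - a) + (d - c)).
assert (HL : 0 <= L) by (unfold L; lra).
(* The [+ 1] covers a rectangle reduced to a point and makes the initial inequality [k * L ^ 2 < I]
   strict. *)
pose (k := I / (L * L + 1)).
assert (HLL : 0 < L * L + 1) by nra.
assert (Hk : 0 < k) by now apply Rdiv_lt_0_compat.
destruct (rectangle_bisection
  (fun a' b' c' d' => (a <= a' /\ b' <= b /\ c <= c' /\ d' <= d) /\
     k * (((b' - a') + (d' - c')) * ((b' - a') + (d' - c'))) <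
     Rabs (boundary_integral P Q a' b' c' d')) a b c d Hab Hcd)
  as (x & y & Hx & Hy & Hacc).
- intros a1 b1 c1 d1 H1 H2 [Hin HB] m l.
  assert (hm : m = (a1 + b1) / 2) by reflexivity.
  assert (hl : l = (c1 + d1) / 2) by reflexivity.
  clearbody m l.
  rewrite (boundary_integral_quarters P Q a1 m b1 c1 l d1) in HB by (lra || (intros; apply Hc; lra)).
  apply NNPP; intros Hno.
  apply not_or_and in Hno; destruct Hno as [n1 Hno].
  apply not_or_and in Hno; destruct Hno as [n2 Hno].
  apply not_or_and in Hno; destruct Hno as [n3 n4].
  (* A quarter has half the semi-perimeter, hence a quarter of the threshold: if all four stayed
     below theirs, the whole rectangle would stay below its own. *)
  assert (q : forall a' b' c' d', b' - a' = (b1 - a1) / 2 -> d' - c' = (d1 - c1) / 2 ->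
     a <= a' /\ b' <= b /\ c <= c' /\ d' <= d ->
     ~ ((a <= a' /\ b' <= b /\ c <= c' /\ d' <= d) /\
     k * (((b' - a') + (d' - c')) * ((b' - a') + (d' - c'))) <
     Rabs (boundary_integral P Q a' b' c' d')) ->
     Rabs (boundary_integral P Q a' b' c' d') <=
     k * (((b1 - a1) + (d1 - c1)) * ((b1 - a1) + (d1 - c1))) / 4).
  { intros a' b' c' d' e1 e2 hin hno. apply Rnot_lt_le; intros hlt; apply hno.
    split; [assumption|]. rewrite e1, e2. lra. }
  apply q in n1; [|lra..]. apply q in n2; [|lra..].
  apply q in n3; [|lra..]. apply q in n4; [|lra..].
  apply Rlt_not_le in HB; apply HB.
  eapply Rle_trans; [apply Rabs_triang|].
  eapply Rle_trans; [apply Rplus_le_compat_r, Rabs_triang|].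
  eapply Rle_trans; [apply Rplus_le_compat_r, Rplus_le_compat_r, Rabs_triang|].
  lra.
- split; [lra|]. fold L I. unfold k.
  apply Rmult_lt_reg_r with (L * L + 1); [assumption|].
  replace (I / (L * L + 1) * (L * L) * (L * L + 1)) with (I * (L * L)) by (field; lra).
  nra.
- destruct (HD x y Hx Hy) as (p1 & p2 & q2 & h1 & h2).
  (* With error [k / 4] per unit of distance, the boundary integral is at most
     [2 * (k / 4 * M) * M], where [M] is the semi-perimeter. *)
  assert (He : 0 < k / 4) by lra.
  destruct (h1 (mkposreal _ He)) as [d1 Hd1].
  destruct (h2 (mkposreal _ He)) as [d2 Hd2]; simpl in Hd1, Hd2.
  destruct (Hacc (Rmin d1 d2))
    as (a' & b' & c' & d' & g1 & g2 & g3 & g4 & g5 & g6 & l1 & l2 & _ & HB).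
  { apply Rmin_glb_lt; [apply d1|apply d2]. }
  pose proof (Rmin_l d1 d2); pose proof (Rmin_r d1 d2).
  apply Rlt_not_le in HB; apply HB; clear HB.
  set (M := (b' - a') + (d' - c')).
  assert (0 <= M) by (unfold M; lra).
  replace (k * (M * M)) with (2 * (k / 4 * M) * M + k * (M * M) / 2) by field.
  apply Rle_trans with (2 * (k / 4 * M) * M); [|nra].
  apply (boundary_integral_affine_error P Q a' b' c' d' x y p1 p2 q2); try lra.
  + intros; apply Hc; lra.
  + intros s t Hs Ht.
    assert (Rabs (s - x) <= b' - a') by (apply Rabs_le; lra).
    assert (Rabs (t - y) <= d' - c') by (apply Rabs_le; lra).
    assert (Rmax (Rabs (s - x)) (Rabs (t - y)) <= M) by (apply Rmax_lub; unfold M; lra).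
    split; (eapply Rle_trans; [first [apply Hd1|apply Hd2]; lra|]);
    apply Rmult_le_compat_l; lra.
Qed.

(** * Cauchy-Riemann pairs and Cauchy's estimate for the derivative *)

Lemma differentiable_pt_lim_fst (x y : R) : differentiable_pt_lim (fun s _ => s) x y 1 0.
Proof.
apply differentiable_pt_lim_proj1_0, derivable_pt_lim_id.
Qed.

Lemma differentiable_pt_lim_swap (g : R -> R -> R) (x y p q : R) :
  differentiable_pt_lim g y x q p -> differentiable_pt_lim (fun s t => g t s) x y p q.
Proof.
intros H e; destruct (H e) as [d Hd]; exists d; intros s t Hs Ht.
rewrite Rmax_comm, Rplus_comm; now apply Hd.
Qed.

Lemma differentiable_pt_lim_proj2 (g : R -> R) (x y l : R) :
  derivable_pt_lim g y l -> differentiable_pt_lim (fun _ t => g t) x y 0 l.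
Proof.
intros H; apply (differentiable_pt_lim_swap (fun t _ => g t)).
now apply differentiable_pt_lim_proj1_0.
Qed.

Lemma differentiable_pt_lim_cst (k x y : R) : differentiable_pt_lim (fun _ _ => k) x y 0 0.
Proof.
apply (differentiable_pt_lim_proj1_0 (fun _ => k)), derivable_pt_lim_const.
Qed.

Lemma differentiable_pt_lim_plus (g h : R -> R -> R) (x y p q p' q' : R) :
  differentiable_pt_lim g x y p q -> differentiable_pt_lim h x y p' q' ->
  differentiable_pt_lim (fun s t => g s t + h s t) x y (p + p') (q + q').
Proof.
intros Hg Hh.
replace (p + p') with (1 * p + 1 * p') by ring.
replace (q + q') with (1 * q + 1 * q') by ring.
apply (differentiable_pt_lim_comp Rplus g h); try assumption.
intros e; exists e; intros s t _ _.
replace (s + t - (g x y + h x y) - _) with 0 by ring.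
rewrite Rabs_R0; apply Rmult_le_pos; [apply Rlt_le, e|].
eapply Rle_trans; [apply Rabs_pos|apply Rmax_l].
Qed.

Lemma differentiable_pt_lim_mult (g h : R -> R -> R) (x y p q p' q' : R) :
  differentiable_pt_lim g x y p q -> differentiable_pt_lim h x y p' q' ->
  differentiable_pt_lim (fun s t => g s t * h s t) x y
    (h x y * p + g x y * p') (h x y * q + g x y * q').
Proof.
intros Hg Hh.
apply (differentiable_pt_lim_comp Rmult g h); try assumption.
intros e; exists e; intros s t Hs Ht.
replace (s * t - g x y * h x y - _) with ((s - g x y) * (t - h x y)) by ring.
rewrite Rabs_mult; apply Rmult_le_compat; try apply Rabs_pos.
- now apply Rlt_le.
- apply Rmax_r.
Qed.

(* Cauchy-Riemann: [u + i v] has complex derivative [p + i q] at [x + i y]. *)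
Definition hol_at (u v : R -> R -> R) (x y p q : R) : Prop :=
  differentiable_pt_lim u x y p (- q) /\ differentiable_pt_lim v x y q p.

Lemma hol_at_plus (u v u' v' : R -> R -> R) (x y p q p' q' : R) :
  hol_at u v x y p q -> hol_at u' v' x y p' q' ->
  hol_at (fun s t => u s t + u' s t) (fun s t => v s t + v' s t) x y (p + p') (q + q').
Proof.
intros [h1 h2] [h3 h4]; split.
- replace (- (q + q')) with (- q + - q') by ring. now apply differentiable_pt_lim_plus.
- now apply differentiable_pt_lim_plus.
Qed.

Lemma hol_at_opp (u v : R -> R -> R) (x y p q : R) :
  hol_at u v x y p q ->
  hol_at (fun s t => - u s t) (fun s t => - v s t) x y (- p) (- q).
Proof.
assert (o : forall g a b, differentiable_pt_lim g x y a b ->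
          differentiable_pt_lim (fun s t => - g s t) x y (- a) (- b)).
{ intros g a b H e; destruct (H e) as [d Hd]; exists d; intros s t Hs Ht.
  rewrite <- Rabs_Ropp; eapply Rle_trans; [|exact (Hd s t Hs Ht)].
  apply Req_le; f_equal; ring. }
intros [h1 h2]; split; now apply o.
Qed.

Lemma hol_at_minus (u v u' v' : R -> R -> R) (x y p q p' q' : R) :
  hol_at u v x y p q -> hol_at u' v' x y p' q' ->
  hol_at (fun s t => u s t - u' s t) (fun s t => v s t - v' s t) x y (p - p') (q - q').
Proof.
intros H H'; exact (hol_at_plus _ _ _ _ _ _ _ _ _ _ H (hol_at_opp _ _ _ _ _ _ H')).
Qed.

Lemma hol_at_shift (u v : R -> R -> R) (h k x y p q : R) :
  hol_at u v (x + h) (y + k) p q ->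
  hol_at (fun s t => u (s + h) (t + k)) (fun s t => v (s + h) (t + k)) x y p q.
Proof.
assert (o : forall g a b, differentiable_pt_lim g (x + h) (y + k) a b ->
          differentiable_pt_lim (fun s t => g (s + h) (t + k)) x y a b).
{ intros g a b H e; destruct (H e) as [d Hd]; exists d; intros s t Hs Ht.
  replace (s - x) with (s + h - (x + h)) in * by ring.
  replace (t - y) with (t + k - (y + k)) in * by ring.
  now apply Hd. }
intros [h1 h2]; split; now apply o.
Qed.

(* In the coordinate [s + i th = log (w - z)], the form
   [(f w - f z) / (w - z)^2 dw / i] becomes [G (ds + i dth) / i] with
   [G = (f (z + exp (s + i th)) - f z) exp (- s - i th)]; its real part is
   [Im G ds + Re G dth], closed and [2 PI]-periodic in [th]. *)
Lemma cauchy_estimate_re (u v : R -> R -> R) (x0 y0 p q t M : R) :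
  0 < t ->
  (forall x y, (x - x0) ^ 2 + (y - y0) ^ 2 <= t ^ 2 -> exists p q, hol_at u v x y p q) ->
  hol_at u v x0 y0 p q ->
  (forall x y, (x - x0) ^ 2 + (y - y0) ^ 2 = t ^ 2 ->
     Rabs (u x y - u x0 y0) <= M /\ Rabs (v x y - v x0 y0) <= M) ->
  Rabs p <= 2 * M / t.
Proof.
intros Ht HD [Hu Hv] HM.
pose (X := fun s th => x0 + exp s * cos th).
pose (Y := fun s th => y0 + exp s * sin th).
pose (U := fun s th => u (X s th) (Y s th) + - u x0 y0).
pose (V := fun s th => v (X s th) (Y s th) + - v x0 y0).
pose (P := fun s th => exp (- s) * (V s th * cos th + (- sin th) * U s th)).
pose (Q := fun s th => exp (- s) * (U s th * cos th + sin th * V s th)).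
assert (cs : forall th, cos th ^ 2 + sin th ^ 2 = 1).
{ intros th; pose proof (sin2_cos2 th) as h; unfold Rsqr in h; lra. }
assert (circ : forall s th, (X s th - x0) ^ 2 + (Y s th - y0) ^ 2 = exp s ^ 2).
{ intros s th; unfold X, Y. specialize (cs th). nra. }
assert (bc : forall th, Rabs (cos th) <= 1 /\ Rabs (sin th) <= 1).
{ intros th; pose proof (COS_bound th); pose proof (SIN_bound th); split; apply Rabs_le; lra. }
assert (dif : forall s th, exp s <= t -> exists p1 p2 q2,
   differentiable_pt_lim P s th p1 p2 /\ differentiable_pt_lim Q s th p2 q2).
{ intros s th Hs.
  destruct (HD (X s th) (Y s th)) as (p' & q' & Hu' & Hv').
  { rewrite circ; apply pow_incr; split; [apply Rlt_le, exp_pos|assumption]. }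
  assert (de : forall s th, differentiable_pt_lim (fun s _ => exp s) s th (exp s) 0).
  { intros; apply differentiable_pt_lim_proj1_0, derivable_pt_lim_exp. }
  assert (de' : forall s th, differentiable_pt_lim (fun s _ => exp (- s)) s th (- exp (- s)) 0).
  { intros; apply (differentiable_pt_lim_proj1_0 (fun s => exp (- s))).
    apply is_derive_Reals; auto_derive; [easy|ring]. }
  assert (dc : forall s th, differentiable_pt_lim (fun _ th => cos th) s th 0 (- sin th)).
  { intros; apply differentiable_pt_lim_proj2, derivable_pt_lim_cos. }
  assert (ds : forall s th, differentiable_pt_lim (fun _ th => sin th) s th 0 (cos th)).
  { intros; apply differentiable_pt_lim_proj2, derivable_pt_lim_sin. }
  assert (ds' : forall s th, differentiable_pt_lim (fun _ th => - sin th) s th 0 (- cos th)).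
  { intros; apply (differentiable_pt_lim_proj2 (fun th => - sin th)).
    apply is_derive_Reals; auto_derive; [easy|ring]. }
  assert (dX := differentiable_pt_lim_plus _ _ _ _ _ _ _ _ (differentiable_pt_lim_cst x0 s th)
     (differentiable_pt_lim_mult _ _ _ _ _ _ _ _ (de s th) (dc s th))).
  assert (dY := differentiable_pt_lim_plus _ _ _ _ _ _ _ _ (differentiable_pt_lim_cst y0 s th)
     (differentiable_pt_lim_mult _ _ _ _ _ _ _ _ (de s th) (ds s th))).
  assert (dU := differentiable_pt_lim_plus _ _ _ _ _ _ _ _
    (differentiable_pt_lim_comp _ _ _ _ _ _ _ _ _ _ _ Hu' dX dY)
    (differentiable_pt_lim_cst (- u x0 y0) s th)).
  assert (dV := differentiable_pt_lim_plus _ _ _ _ _ _ _ _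
    (differentiable_pt_lim_comp _ _ _ _ _ _ _ _ _ _ _ Hv' dX dY)
    (differentiable_pt_lim_cst (- v x0 y0) s th)).
  assert (dP := differentiable_pt_lim_mult _ _ _ _ _ _ _ _ (de' s th)
    (differentiable_pt_lim_plus _ _ _ _ _ _ _ _
      (differentiable_pt_lim_mult _ _ _ _ _ _ _ _ dV (dc s th))
      (differentiable_pt_lim_mult _ _ _ _ _ _ _ _ (ds' s th) dU))).
  assert (dQ := differentiable_pt_lim_mult _ _ _ _ _ _ _ _ (de' s th)
    (differentiable_pt_lim_plus _ _ _ _ _ _ _ _
      (differentiable_pt_lim_mult _ _ _ _ _ _ _ _ dU (dc s th))
      (differentiable_pt_lim_mult _ _ _ _ _ _ _ _ (ds s th) dV))).
  cbv beta in dP, dQ.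
  (* The partial derivatives are read off the computed differentials. That the [th]-derivative of
     [P] equals the [s]-derivative of [Q] is a ring identity, because [Hu'] and [Hv'] already carry
     the Cauchy-Riemann relations. *)
  match type of dQ with differentiable_pt_lim _ _ _ ?a ?b =>
    match type of dP with differentiable_pt_lim _ _ _ ?p1 ?p2 =>
      exists p1, p2, b; split; [exact dP|]; replace p2 with a; [exact dQ|] end end.
  ring. }
assert (per : forall s, P s 0 = P s (2 * PI)).
{ intros s; unfold P, U, V, X, Y. rewrite cos_2PI, sin_2PI, cos_0, sin_0; reflexivity. }
(* [Q] is the real part of the difference quotient of [f] on the circle of radius [exp s]. Its mean
   does not depend on the radius: in Goursat's lemma on [[s0, ln t] x [0, 2 PI]] the sides [th = 0]
   and [th = 2 PI] cancel by [per]. *)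
assert (const : forall s0, s0 <= ln t ->
   RInt (fun th => Q s0 th) 0 (2 * PI) = RInt (fun th => Q (ln t) th) 0 (2 * PI)).
{ intros s0 Hs0.
  pose proof PI_RGT_0.
  pose proof (goursat_rectangle P Q s0 (ln t) 0 (2 * PI) Hs0 ltac:(lra)) as G.
  lapply G; clear G.
  - unfold boundary_integral.
    rewrite (RInt_ext (fun x => P x 0) (fun x => P x (2 * PI))) by (intros; apply per).
    lra.
  - intros s th [_ Hs] _; apply dif. rewrite <- (exp_ln t) by assumption.
    destruct Hs as [Hs| ->]; [left; now apply exp_increasing|right; reflexivity]. }
assert (int : forall s, s <= ln t -> ex_RInt (fun th => Q s th) 0 (2 * PI)).
{ intros s Hs; pose proof PI_RGT_0. apply ex_RInt_continuous_le; [lra|]; intros th _.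
  destruct (dif s th) as (p1 & p2 & q2 & _ & h).
  - rewrite <- (exp_ln t) by assumption.
    destruct Hs as [Hs| ->]; [left; now apply exp_increasing|right; reflexivity].
  - eapply continuity_2d_pt_slice_y, differentiable_pt_lim_continuity_2d, h. }
(* On the outer circle the factor [exp (- s)] is [1 / t], and [U cos + V sin] is at most [2 * M]. *)
assert (outer : Rabs (RInt (fun th => Q (ln t) th) 0 (2 * PI)) <= (2 * PI - 0) * (2 * M / t)).
{ pose proof PI_RGT_0. apply abs_RInt_le_const; [lra|apply int; lra|].
  intros th _. unfold Q. rewrite exp_Ropp, exp_ln by assumption.
  destruct (HM (X (ln t) th) (Y (ln t) th)) as [m1 m2].
  { rewrite circ, exp_ln by assumption; reflexivity. }
  change (Rabs (U (ln t) th) <= M) in m1. change (Rabs (V (ln t) th) <= M) in m2.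
  destruct (bc th) as [b1 b2].
  rewrite Rabs_mult, Rabs_inv, (Rabs_pos_eq t) by lra.
  unfold Rdiv; rewrite (Rmult_comm (2 * M)). apply Rmult_le_compat_l; [now apply Rlt_le, Rinv_0_lt_compat|].
  eapply Rle_trans; [apply Rabs_triang|]. rewrite !Rabs_mult.
  pose proof (Rabs_pos (U (ln t) th)); pose proof (Rabs_pos (V (ln t) th)).
  nra. }
apply le_epsilon; intros e He.
assert (He2 : 0 < e / 2) by lra.
destruct (Hu (mkposreal _ He2)) as [d1 Hd1]; destruct (Hv (mkposreal _ He2)) as [d2 Hd2].
simpl in Hd1, Hd2.
pose (rho := Rmin t (Rmin d1 d2) / 2).
assert (Hrho : 0 < rho).
{ unfold rho; pose proof (cond_pos d1); pose proof (cond_pos d2).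
  assert (0 < Rmin t (Rmin d1 d2)) by (repeat apply Rmin_glb_lt; assumption); lra. }
assert (Hr1 : rho < t /\ rho < d1 /\ rho < d2).
{ unfold rho in *; pose proof (Rmin_l t (Rmin d1 d2)); pose proof (Rmin_r t (Rmin d1 d2)).
  pose proof (Rmin_l d1 d2); pose proof (Rmin_r d1 d2); lra. }
assert (Hs0 : ln rho <= ln t) by (left; apply ln_increasing; lra).
(* At radius [rho] the first-order expansions of [u] and [v] at the centre give
   [Q = p + (A cos + B sin) / rho]: the terms in [q] cancel and [p] gets the factor [cos^2 + sin^2].
   Each of [A], [B] is at most [e / 2 * rho]. *)
assert (inner : Rabs (RInt (fun th => Q (ln rho) th - p) 0 (2 * PI)) <= (2 * PI - 0) * e).
{ pose proof PI_RGT_0. apply abs_RInt_le_const; [lra| |].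
  - apply (ex_RInt_minus (V := R_NormedModule)); [now apply int|apply ex_RInt_const].
  - intros th _.
    assert (Ex : X (ln rho) th - x0 = rho * cos th).
    { unfold X; rewrite exp_ln by assumption; ring. }
    assert (Ey : Y (ln rho) th - y0 = rho * sin th).
    { unfold Y; rewrite exp_ln by assumption; ring. }
    destruct (bc th) as [b1 b2].
    assert (ax : Rabs (rho * cos th) <= rho).
    { rewrite Rabs_mult, (Rabs_pos_eq rho) by lra; nra. }
    assert (ay : Rabs (rho * sin th) <= rho).
    { rewrite Rabs_mult, (Rabs_pos_eq rho) by lra; nra. }
    specialize (Hd1 (X (ln rho) th) (Y (ln rho) th)).
    specialize (Hd2 (X (ln rho) th) (Y (ln rho) th)).
    rewrite Ex, Ey in Hd1, Hd2.
    specialize (Hd1 ltac:(lra) ltac:(lra)); specialize (Hd2 ltac:(lra) ltac:(lra)).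
    assert (mx : Rmax (Rabs (rho * cos th)) (Rabs (rho * sin th)) <= rho) by now apply Rmax_lub.
    set (A := u _ _ - u x0 y0 - _) in Hd1. set (B := v _ _ - v x0 y0 - _) in Hd2.
    assert (hA : Rabs A <= e / 2 * rho).
    { eapply Rle_trans; [exact Hd1|]; apply Rmult_le_compat_l; lra. }
    assert (hB : Rabs B <= e / 2 * rho).
    { eapply Rle_trans; [exact Hd2|]; apply Rmult_le_compat_l; lra. }
    replace (Q (ln rho) th - p) with (Q (ln rho) th - p * (cos th ^ 2 + sin th ^ 2))
      by (rewrite cs; ring).
    replace (Q (ln rho) th - p * (cos th ^ 2 + sin th ^ 2)) with (/ rho * (A * cos th + sin th * B)).
    + rewrite Rabs_mult, Rabs_inv, (Rabs_pos_eq rho) by lra.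
      apply Rmult_le_reg_l with rho; [assumption|].
      rewrite <- Rmult_assoc, Rinv_r, Rmult_1_l by lra.
      eapply Rle_trans; [apply Rabs_triang|]. rewrite !Rabs_mult.
      pose proof (Rabs_pos A); pose proof (Rabs_pos B). nra.
    + unfold Q, U, V, A, B. rewrite exp_Ropp, exp_ln by assumption.
      field; lra. }
assert (Hm := RInt_minus (V := R_CompleteNormedModule) (fun th => Q (ln rho) th) (fun _ => p) 0 (2 * PI)
   (int _ Hs0) (ex_RInt_const _ _ _)).
unfold minus, plus, opp in Hm; simpl in Hm.
unfold Rminus in inner at 1; rewrite Hm, RInt_const, (const _ Hs0) in inner.
unfold scal in inner; simpl in inner; unfold mult in inner; simpl in inner.
pose proof PI_RGT_0.
set (J := RInt _ _ _) in *.
apply Rabs_le_between in inner, outer.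
apply Rmult_le_reg_l with (2 * PI); [lra|].
rewrite <- (Rabs_pos_eq (2 * PI)) at 1 by lra. rewrite <- Rabs_mult.
apply Rabs_le; split; lra.
Qed.

(** * Persistence of sign changes and the rightmost zero *)

Lemma zero_of_sign_change (g : R -> R) (a b : R) :
  a < b -> (forall x, a <= x <= b -> continuous g x) -> 0 < g a -> g b < 0 ->
  exists x, a <= x <= b /\ g x = 0.
Proof.
intros Hab Hc Ha Hb.
destruct (IVT_interv (fun x => - g x) a b) as [x [Hx Hx']]; try lra.
- intros x Hx. apply continuity_pt_filterlim. apply (continuous_opp g), Hc, Hx.
- exists x; split; [assumption|lra].
Qed.

Lemma continuity_2d_pt_gt (g : R -> R -> R) (x y m : R) :
  continuity_2d_pt g x y -> m < g x y -> locally_2d (fun s t => m < g s t) x y.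
Proof.
intros H Hm; assert (He : 0 < g x y - m) by lra.
destruct (H (mkposreal _ He)) as [e Hd]; exists e; intros s t Hs Ht.
specialize (Hd s t Hs Ht); simpl in Hd. apply Rabs_lt_between in Hd; lra.
Qed.

Lemma continuity_2d_pt_lt (g : R -> R -> R) (x y m : R) :
  continuity_2d_pt g x y -> g x y < m -> locally_2d (fun s t => g s t < m) x y.
Proof.
intros H Hm; assert (He : 0 < m - g x y) by lra.
destruct (H (mkposreal _ He)) as [e Hd]; exists e; intros s t Hs Ht.
specialize (Hd s t Hs Ht); simpl in Hd. apply Rabs_lt_between in Hd; lra.
Qed.

Lemma decreasing_crossing (g : R -> R) (y l e : R) :
  is_derive g y l -> l < 0 -> g y = 0 -> 0 < e ->
  exists h, 0 < h < e /\ 0 < g (y - h) /\ g (y + h) < 0.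
Proof.
intros Hd Hl Hy He.
apply is_derive_Reals in Hd. destruct (Hd (- l)) as [d Hd']; [lra|].
pose proof (cond_pos d) as Hdp.
pose (h := Rmin (d / 2) (e / 2)).
assert (Hh : 0 < h < e /\ h < d).
{ unfold h; pose proof (Rmin_l (d / 2) (e / 2)); pose proof (Rmin_r (d / 2) (e / 2)).
  assert (0 < Rmin (d / 2) (e / 2)) by (apply Rmin_glb_lt; lra). lra. }
exists h; split; [tauto|].
assert (Ha : forall k, k <> 0 -> Rabs k < d -> g (y + k) / k < 0).
{ intros k Hk Hk'. specialize (Hd' k Hk Hk'). rewrite Hy, Rminus_0_r in Hd'.
  apply Rabs_lt_between in Hd'; lra. }
split.
- specialize (Ha (- h) ltac:(lra)). rewrite Rabs_Ropp, Rabs_pos_eq in Ha by lra.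
  specialize (Ha ltac:(lra)). replace (y - h) with (y + - h) by ring.
  assert (E : g (y + - h) = (g (y + - h) / - h) * - h) by (field; lra).
  rewrite E; nra.
- specialize (Ha h ltac:(lra)). rewrite Rabs_pos_eq in Ha by lra.
  specialize (Ha ltac:(lra)).
  assert (E : g (y + h) = (g (y + h) / h) * h) by (field; lra).
  rewrite E; nra.
Qed.

(* Among the zeros of [v] with [v_y <= 0], a rightmost one is degenerate:
   a zero with [v_y < 0] persists when [x] is increased a little. *)
Lemma vertical_tangency (v w : R -> R -> R) (d : R) :
  0 < d ->
  (forall x y, - d <= x <= d -> - d <= y <= d ->
     continuity_2d_pt v x y /\ continuity_2d_pt w x y /\
     is_derive (fun t => v x t) y (w x y)) ->
  0 < v (- d) (- d) -> v (- d) d < 0 ->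
  (forall y, - d <= y <= d -> w (- d) y < 0) ->
  (forall y, - d <= y <= d -> 0 < w d y) ->
  (forall x, - d <= x <= d -> w x d <= 0 -> v x d <> 0) ->
  (forall x, - d <= x <= d -> w x (- d) <= 0 -> v x (- d) <> 0) ->
  exists x y, - d <= x <= d /\ - d <= y <= d /\ v x y = 0 /\ w x y = 0.
Proof.
intros Hd Hreg Hl1 Hl2 Hl3 Hr Ht Hb.
pose (A := fun x y => - d <= x <= d /\ - d <= y <= d /\ v x y = 0 /\ w x y <= 0).
assert (A0 : exists y, A (- d) y).
{ destruct (zero_of_sign_change (fun t => v (- d) t) (- d) d) as [y [Hy Hy']]; try lra.
  - intros t Ht'; apply continuity_2d_pt_slice_y, Hreg; lra.
  - exists y; repeat split; try lra. specialize (Hl3 y Hy); lra. }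
destruct A0 as [y0 A0].
destruct (completeness (fun x => exists y, A x y)) as [s [ub lub]].
{ exists d; intros x [y (Hx & _)]; lra. }
{ exists (- d), y0; exact A0. }
assert (Hs : - d <= s <= d).
{ split; [apply ub; exists y0; exact A0|].
  apply lub; intros x [y (Hx & _)]; lra. }
assert (near : forall e, 0 < e -> exists x y, A x y /\ s - e < x <= s).
{ intros e He. apply NNPP; intros Hno.
  assert (s <= s - e); [|lra]. apply lub; intros x [y Hxy].
  apply Rnot_lt_le; intros Hlt; apply Hno; exists x, y; repeat split; try apply Hxy; try lra.
  apply ub; exists y; exact Hxy. }
(* Bisection of the vertical segment [x = s] finds a height [y] at which points of [A] with abscissa
   close to the supremum [s] accumulate. *)
destruct (rectangle_bisection
  (fun _ _ c' d' => forall e, 0 < e -> exists x y, A x y /\ s - e < x <= s /\ c' <= y <= d')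
  s s (- d) d) as (s' & y & Hs' & Hy & Hacc); try lra.
- intros a' b' c' d' _ _ HB m k.
  apply NNPP; intros Hno.
  assert (n1 : ~ forall e, 0 < e -> exists x y, A x y /\ s - e < x <= s /\ c' <= y <= k) by tauto.
  assert (n2 : ~ forall e, 0 < e -> exists x y, A x y /\ s - e < x <= s /\ k <= y <= d') by tauto.
  apply not_all_ex_not in n1, n2. destruct n1 as [e1 n1], n2 as [e2 n2].
  apply imply_to_and in n1, n2. destruct n1 as [p1 n1], n2 as [p2 n2].
  destruct (HB (Rmin e1 e2)) as (x & t & HA & Hx & Ht').
  { now apply Rmin_glb_lt. }
  pose proof (Rmin_l e1 e2); pose proof (Rmin_r e1 e2).
  destruct (Rle_lt_dec t k).
  + apply n1; exists x, t; repeat split; try apply HA; lra.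
  + apply n2; exists x, t; repeat split; try apply HA; lra.
- intros e He; destruct (near e He) as (x & t & HA & Hx).
  exists x, t; repeat split; try apply HA; lra.
- assert (s' = s) by lra; subst s'; clear Hs'.
  destruct (Hreg s y Hs Hy) as (cv & cw & dv).
  assert (close : forall e : posreal, exists x t, A x t /\ Rabs (x - s) < e /\ Rabs (t - y) < e).
  { intros e; destruct (Hacc e (cond_pos e))
      as (a' & b' & c' & d' & _ & _ & _ & _ & h1 & _ & _ & h2 & HB).
    destruct (HB e (cond_pos e)) as (x & t & HA & Hx & Ht').
    exists x, t; repeat split; try apply HA; apply Rabs_lt_between; lra. }
  (* Both [v = 0] and [w <= 0] are closed conditions, so they pass to the accumulation point. *)
  assert (vz : v s y = 0).
  { destruct (Rtotal_order (v s y) 0) as [h|[h|h]]; [exfalso|assumption|exfalso].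
    - destruct (continuity_2d_pt_lt _ _ _ _ cv h) as [e Hloc].
      destruct (close e) as (x & t & HA & Hx & Ht').
      specialize (Hloc x t Hx Ht'). destruct HA as (_ & _ & HA & _); lra.
    - destruct (continuity_2d_pt_gt _ _ _ _ cv h) as [e Hloc].
      destruct (close e) as (x & t & HA & Hx & Ht').
      specialize (Hloc x t Hx Ht'). destruct HA as (_ & _ & HA & _); lra. }
  assert (wn : w s y <= 0).
  { apply Rnot_lt_le; intros h.
    destruct (continuity_2d_pt_gt _ _ _ _ cw h) as [e Hloc].
    destruct (close e) as (x & t & HA & Hx & Ht').
    specialize (Hloc x t Hx Ht'). destruct HA as (_ & _ & _ & HA); lra. }
  (* If [w s y < 0], the hypotheses on the sides keep the point off the right, top and bottom ones,
     and [v s] changes sign from plus to minus across [y]. The two signs and [w < 0] persist on the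
     line [x = s + k], which yields a point of [A] beyond the supremum. *)
  destruct wn as [wn|wz]; [exfalso|exists s, y; tauto].
  assert (sd : s < d).
  { destruct (proj2 Hs) as [h|h]; [assumption|]. subst s. specialize (Hr y Hy); lra. }
  assert (yd : - d < y < d).
  { split.
    - destruct (proj1 Hy) as [h|h]; [assumption|]. subst y. exfalso; apply (Hb s Hs); lra.
    - destruct (proj2 Hy) as [h|h]; [assumption|]. subst y. exfalso; apply (Ht s Hs); lra. }
  destruct (continuity_2d_pt_lt _ _ _ _ cw wn) as [e Hloc].
  destruct (decreasing_crossing (fun t => v s t) y (w s y)
     (Rmin e (Rmin (d - y) (y + d))) dv wn vz) as (h & [h0 h1] & h2 & h3).
  { repeat apply Rmin_glb_lt; try lra; apply cond_pos. }
  pose proof (Rmin_l e (Rmin (d - y) (y + d))); pose proof (Rmin_r e (Rmin (d - y) (y + d))).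
  pose proof (Rmin_l (d - y) (y + d)); pose proof (Rmin_r (d - y) (y + d)).
  destruct (continuity_2d_pt_gt v s (y - h) 0) as [e1 He1]; [apply Hreg; lra|assumption|].
  destruct (continuity_2d_pt_lt v s (y + h) 0) as [e2 He2]; [apply Hreg; lra|assumption|].
  pose (k := Rmin (d - s) (Rmin e (Rmin e1 e2)) / 2).
  assert (Hk : 0 < k).
  { assert (0 < Rmin (d - s) (Rmin e (Rmin e1 e2))); [|unfold k; lra].
    repeat apply Rmin_glb_lt; try lra; apply cond_pos. }
  assert (Hk' : k < d - s /\ k < e /\ k < e1 /\ k < e2).
  { unfold k in *.
    pose proof (Rmin_l (d - s) (Rmin e (Rmin e1 e2))); pose proof (Rmin_r (d - s) (Rmin e (Rmin e1 e2))).
    pose proof (Rmin_l e (Rmin e1 e2)); pose proof (Rmin_r e (Rmin e1 e2)).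
    pose proof (Rmin_l e1 e2); pose proof (Rmin_r e1 e2); lra. }
  assert (ak : Rabs (s + k - s) = k).
  { replace (s + k - s) with k by ring; apply Rabs_pos_eq; lra. }
  assert (z : forall t, Rabs (t - t) = 0) by (intros t; rewrite Rminus_eq_0; apply Rabs_R0).
  destruct (zero_of_sign_change (fun t => v (s + k) t) (y - h) (y + h)) as (t & Ht1 & Ht2); try lra.
  + intros t Ht1; apply continuity_2d_pt_slice_y, Hreg; lra.
  + apply He1; [rewrite ak; tauto|rewrite z; apply e1].
  + apply He2; [rewrite ak; tauto|rewrite z; apply e2].
  + assert (s + k <= s); [|lra]. apply ub; exists t; repeat split; try lra.
    left; apply Hloc; [rewrite ak; tauto|]. apply Rabs_lt_between; lra.
Qed.

(** * Complex functions as Cauchy-Riemann pairs; continuity of the derivative *)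

Lemma sqrt2_le_2 : sqrt 2 <= 2.
Proof.
rewrite <- (sqrt_square 2) at 2 by lra; apply sqrt_le_1_alt; lra.
Qed.

Lemma Cmod_le_2Rmax (x y : R) : Cmod (x, y) <= 2 * Rmax (Rabs x) (Rabs y).
Proof.
eapply Rle_trans; [apply Cmod_2Rmax|]; simpl.
apply Rmult_le_compat_r; [|apply sqrt2_le_2].
eapply Rle_trans; [apply Rabs_pos|apply Rmax_l].
Qed.

Lemma Rabs_Re_Im_le_Cmod (z : C) : Rabs (Re z) <= Cmod z /\ Rabs (Im z) <= Cmod z.
Proof.
pose proof (Rmax_Cmod z) as h; unfold Re, Im.
pose proof (Rmax_l (Rabs (fst z)) (Rabs (snd z))).
pose proof (Rmax_r (Rabs (fst z)) (Rabs (snd z))); lra.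
Qed.

Lemma disc_0 (r : R) (z : C) : Cmod z < r -> disc 0%C r z.
Proof.
intros Hz; unfold disc; replace (z - 0)%C with z by ring; exact Hz.
Qed.

Lemma is_derive_hol_at (f : C -> C) (x y : R) (l : C) :
  @is_derive C_AbsRing C_NormedModule f (x, y) l ->
  hol_at (fun s t => Re (f (s, t))) (fun s t => Im (f (s, t))) x y (Re l) (Im l).
Proof.
intros [_ H].
specialize (H (x, y) (fun P HP => HP)).
assert (key : forall e : posreal, exists d : posreal, forall s t,
  Rabs (s - x) < d -> Rabs (t - y) < d ->
  Cmod (f (s, t) - f (x, y) - ((s - x)%R, (t - y)%R) * l)%C <= e * Rmax (Rabs (s - x)) (Rabs (t - y))).
(* Both [e] and [d] are halved because [Cmod] is at most twice the max norm in which real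
   differentiability is stated. *)
{ intros e. assert (He : 0 < e / 2) by (pose proof (cond_pos e); lra).
  destruct (H (mkposreal _ He)) as [d Hd].
  assert (Hd2 : 0 < d / 2) by (pose proof (cond_pos d); lra).
  exists (mkposreal _ Hd2); simpl; intros s t Hs Ht.
  pose proof (Cmod_le_2Rmax (s - x) (t - y)) as hC.
  assert (hb : Cmod (s - x, t - y) < d).
  { eapply Rle_lt_trans; [exact hC|].
    assert (Rmax (Rabs (s - x)) (Rabs (t - y)) < d / 2) by now apply Rmax_lub_lt.
    lra. }
  specialize (Hd (s, t) hb).
  change (Cmod (f (s, t) - f (x, y) - ((s - x)%R, (t - y)%R) * l)%C <= e / 2 * Cmod (s - x, t - y)) in Hd.
  eapply Rle_trans; [exact Hd|]. pose proof (cond_pos e). nra. }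
split; intros e; destruct (key e) as [d Hd]; exists d; intros s t Hs Ht;
  (eapply Rle_trans; [|exact (Hd s t Hs Ht)]);
  [eapply Rle_trans; [|apply (proj1 (Rabs_Re_Im_le_Cmod _))]
  |eapply Rle_trans; [|apply (proj2 (Rabs_Re_Im_le_Cmod _))]];
  apply Req_le; f_equal; unfold Re, Im; simpl; ring.
Qed.

(** This is [a0 + a2 z^2 + a3 z^3] with its derivative, split into real and imaginary parts. It is
    subtracted from a nearby function so that Cauchy's estimate applies to a small difference. *)
Lemma hol_at_cubic (a0 a2 a3 x y : R) :
  hol_at (fun x y => a0 + a2 * (x * x - y * y) + a3 * (x * x * x - 3 * (x * y * y)))
         (fun x y => a2 * (2 * (x * y)) + a3 * (3 * (x * x * y) - y * y * y)) x y
         (2 * a2 * x + 3 * a3 * (x * x - y * y)) (2 * a2 * y + 6 * a3 * (x * y)).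
Proof.
assert (X := differentiable_pt_lim_fst x y).
assert (Y : differentiable_pt_lim (fun _ t => t) x y 0 1)
  by (apply differentiable_pt_lim_proj2, derivable_pt_lim_id).
assert (K := fun k => differentiable_pt_lim_cst k x y).
assert (P := fun g h p q p' q' => differentiable_pt_lim_plus g h x y p q p' q').
assert (M := fun g h p q p' q' => differentiable_pt_lim_mult g h x y p q p' q').
assert (XX := M _ _ _ _ _ _ X X). assert (YY := M _ _ _ _ _ _ Y Y).
assert (XY := M _ _ _ _ _ _ X Y).
assert (XXX := M _ _ _ _ _ _ XX X). assert (YYY := M _ _ _ _ _ _ YY Y).
assert (XXY := M _ _ _ _ _ _ XX Y). assert (XYY := M _ _ _ _ _ _ XY Y).
assert (E : forall g h p q p' q', differentiable_pt_lim g x y p q ->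
   (forall s t, g s t = h s t) -> p = p' -> q = q' -> differentiable_pt_lim h x y p' q').
{ intros g h p q p' q' Hg He <- <-; apply (differentiable_pt_lim_ext g); [|assumption].
  exists (mkposreal 1 Rlt_0_1); intros; apply He. }
split.
- eapply E; [exact (P _ _ _ _ _ _ (K a0) (P _ _ _ _ _ _
    (M _ _ _ _ _ _ (K a2) (P _ _ _ _ _ _ XX (M _ _ _ _ _ _ (K (-1)) YY)))
    (M _ _ _ _ _ _ (K a3) (P _ _ _ _ _ _ XXX (M _ _ _ _ _ _ (K (-3)) XYY)))))|..];
  intros; simpl; ring.
- eapply E; [exact (P _ _ _ _ _ _
    (M _ _ _ _ _ _ (K (2 * a2)) XY)
    (M _ _ _ _ _ _ (K a3) (P _ _ _ _ _ _ (M _ _ _ _ _ _ (K 3) XXY) (M _ _ _ _ _ _ (K (-1)) YYY))))|..];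
  intros; simpl; ring.
Qed.

(** Cauchy's estimate is applied to the difference between the function and its translate by
    [(s - x, t - y)], which uniform continuity makes small; the derivative of that difference at
    [(x, y)] has real part [W s t - W x y]. *)
Lemma hol_derivative_continuous (u v W Z : R -> R -> R) (d : R) :
  0 < d ->
  (forall x y, - (2 * d) <= x <= 2 * d -> - (2 * d) <= y <= 2 * d ->
     hol_at u v x y (W x y) (Z x y)) ->
  forall x y, - d <= x <= d -> - d <= y <= d -> continuity_2d_pt W x y.
Proof.
intros Hd Hh x y Hx Hy e.
(* Subtracting the value at the centre doubles this bound, and the estimate on a disc of radius
   [d / 2] then gives [e / 2]. Radius and translation are both at most [d / 2], so all points stay
   in the square of half-side [2 * d]. *)
assert (He : 0 < e * d / 16) by (pose proof (cond_pos e); nra).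
destruct (uniform_continuity_2d u (- (2 * d)) (2 * d) (- (2 * d)) (2 * d)) with (eps := mkposreal _ He)
  as [d1 H1].
{ intros s t Hs Ht; eapply differentiable_pt_lim_continuity_2d; apply (Hh s t Hs Ht). }
destruct (uniform_continuity_2d v (- (2 * d)) (2 * d) (- (2 * d)) (2 * d)) with (eps := mkposreal _ He)
  as [d2 H2].
{ intros s t Hs Ht; eapply differentiable_pt_lim_continuity_2d; apply (Hh s t Hs Ht). }
simpl in H1, H2.
assert (Hm : 0 < Rmin (d / 2) (Rmin d1 d2)).
{ repeat apply Rmin_glb_lt; try lra; apply cond_pos. }
exists (mkposreal _ Hm); simpl; intros s t Hs Ht.
pose proof (Rmin_l (d / 2) (Rmin d1 d2)); pose proof (Rmin_r (d / 2) (Rmin d1 d2)).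
pose proof (Rmin_l d1 d2); pose proof (Rmin_r d1 d2).
assert (Hs' : - (d / 2) <= s - x <= d / 2) by (apply Rabs_le_between; lra).
assert (Ht' : - (d / 2) <= t - y <= d / 2) by (apply Rabs_le_between; lra).
assert (disk : forall a b, (a - x) ^ 2 + (b - y) ^ 2 <= (d / 2) ^ 2 ->
   - (d / 2) <= a - x <= d / 2 /\ - (d / 2) <= b - y <= d / 2).
{ intros a b Hab; apply triangle_rectangle; [lra|rewrite !Rsqr_pow2; assumption]. }
assert (dh : forall a b, - (3 * d / 2) <= a <= 3 * d / 2 -> - (3 * d / 2) <= b <= 3 * d / 2 ->
  hol_at (fun a b => u (a + (s - x)) (b + (t - y)) - u a b)
         (fun a b => v (a + (s - x)) (b + (t - y)) - v a b) a b
         (W (a + (s - x)) (b + (t - y)) - W a b) (Z (a + (s - x)) (b + (t - y)) - Z a b)).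
{ intros a b Ha Hb. apply hol_at_minus; [apply hol_at_shift|]; apply Hh; lra. }
assert (small : forall a b, - (3 * d / 2) <= a <= 3 * d / 2 -> - (3 * d / 2) <= b <= 3 * d / 2 ->
   Rabs (u (a + (s - x)) (b + (t - y)) - u a b) < e * d / 16 /\
   Rabs (v (a + (s - x)) (b + (t - y)) - v a b) < e * d / 16).
{ intros a b Ha Hb; split; [apply H1|apply H2]; try lra;
  [replace (a + (s - x) - a) with (s - x) by ring
  |replace (b + (t - y) - b) with (t - y) by ring
  |replace (a + (s - x) - a) with (s - x) by ring
  |replace (b + (t - y) - b) with (t - y) by ring]; lra. }
pose proof (cauchy_estimate_re _ _ x y _ _ (d / 2) (2 * (e * d / 16)) ltac:(lra)
  (fun a b Hab => ex_intro _ _ (ex_intro _ _ (dh a b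
     ltac:(pose proof (disk a b Hab); lra) ltac:(pose proof (disk a b Hab); lra))))
  (dh x y ltac:(lra) ltac:(lra))) as CE.
lapply CE; clear CE.
- intros CE. replace (x + (s - x)) with s in CE by ring. replace (y + (t - y)) with t in CE by ring.
  eapply Rle_lt_trans; [exact CE|]. pose proof (cond_pos e).
  replace (2 * (2 * (e * d / 16)) / (d / 2)) with (e / 2) by (field; lra). lra.
- intros a b Hab. pose proof (disk a b (Req_le _ _ Hab)).
  destruct (small a b) as [s1 s2]; try lra. destruct (small x y) as [s3 s4]; try lra.
  apply Rabs_lt_between in s1, s2, s3, s4. split; apply Rabs_le; lra.
Qed.

(** * Compact squares, the Taylor remainder, and the choice of a null sequence *)

Definition box (d : R) (z : C) : Prop := - d <= fst z <= d /\ - d <= snd z <= d.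

(** A rectangle is bad when it has no finite subcover. The limit point of the bisection lies in a
    single open [U i], which already contains a small bad rectangle. *)
Lemma box_compact (d : R) : 0 <= d -> compact_set (box d).
Proof.
intros Hd I U HU Hcov; apply NNPP; intros Hno.
destruct (rectangle_bisection (fun a b c e => ~ exists l : list I, forall z : C,
    a <= fst z <= b -> c <= snd z <= e -> exists i, In i l /\ U i z) (- d) d (- d) d)
  as (x & y & Hx & Hy & Hacc); try lra.
- intros a b c e _ _ HB m k.
  apply NNPP; intros Hn. apply not_or_and in Hn; destruct Hn as [n1 Hn].
  apply not_or_and in Hn; destruct Hn as [n2 Hn].
  apply not_or_and in Hn; destruct Hn as [n3 n4].
  apply NNPP in n1, n2, n3, n4.
  destruct n1 as [l1 n1], n2 as [l2 n2], n3 as [l3 n3], n4 as [l4 n4].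
  apply HB; exists (l1 ++ l2 ++ l3 ++ l4); intros z Hz1 Hz2.
  destruct (Rle_lt_dec (fst z) m), (Rle_lt_dec (snd z) k).
  + destruct (n1 z) as [i [Hi Hi']]; try lra; exists i; rewrite !in_app_iff; tauto.
  + destruct (n3 z) as [i [Hi Hi']]; try lra; exists i; rewrite !in_app_iff; tauto.
  + destruct (n2 z) as [i [Hi Hi']]; try lra; exists i; rewrite !in_app_iff; tauto.
  + destruct (n4 z) as [i [Hi Hi']]; try lra; exists i; rewrite !in_app_iff; tauto.
- intros [l Hl]; apply Hno; exists l; intros z [h1 h2]; now apply Hl.
- destruct (Hcov (x, y)) as [i Hi]; [split; simpl; lra|].
  destruct (HU i (x, y) Hi) as [e He].
  destruct (Hacc e (cond_pos e)) as (a & b & c & g & h1 & h2 & h3 & h4 & h5 & h6 & h7 & h8 & HB).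
  apply HB; exists (i :: nil); intros z Hz1 Hz2; exists i; split; [now left|].
  apply He; split; apply Rabs_lt_between; simpl; unfold minus, plus, opp; simpl; lra.
Qed.

(** Convergence at [rho = r / 2] bounds the terms there; for [Cmod z <= r / 4] the tail from index 4
    is then dominated by a geometric series of ratio at most [1 / 2]. *)
Lemma pseries_cubic_remainder (a : nat -> C) (f : C -> C) (r : R) :
  0 < r ->
  (forall z : C, disc 0%C r z -> @is_pseries C_AbsRing C_NormedModule a z (f z)) ->
  exists M, 0 < M /\ forall z : C, Cmod z <= r / 4 ->
    Cmod (f z - (a 0%nat + a 1%nat * z + a 2%nat * (z * z) + a 3%nat * (z * z * z)))%C
      <= M * Cmod z ^ 4.
Proof.
intros Hr Hs.
pose proof (disc_0 r) as D.
pose (t := (fun z k => @scal C_AbsRing C_NormedModule (pow_n z k) (a k)) : C -> nat -> C).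
assert (pm : forall z k, Cmod (@pow_n C_AbsRing z k) = Cmod z ^ k).
{ intros z k; induction k as [|k IH]; simpl; [apply Cmod_1|].
  change (Cmod (z * @pow_n C_AbsRing z k)%C = Cmod z * Cmod z ^ k). now rewrite Cmod_mult, IH. }
assert (tm : forall z k, Cmod (t z k) = Cmod z ^ k * Cmod (a k)).
{ intros z k; unfold t. change (Cmod (@pow_n C_AbsRing z k * a k)%C = Cmod z ^ k * Cmod (a k)).
  now rewrite Cmod_mult, pm. }
pose (rho := r / 2).
assert (cr : Cmod (RtoC rho) = rho) by (rewrite Cmod_R; apply Rabs_pos_eq; unfold rho; lra).
assert (Hbd := Hs (RtoC rho) ltac:(apply D; rewrite cr; unfold rho; lra)).
destruct (filterlim_bounded _ (ex_intro _ _ Hbd)) as [B HB].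
assert (B0 : 0 <= B) by (eapply Rle_trans; [apply Cmod_ge_0|exact (HB O)]).
assert (coef : forall k, rho ^ S k * Cmod (a (S k)) <= 2 * B).
{ intros k. rewrite <- cr at 1; rewrite <- tm.
  pose proof (HB (S k)) as h1; pose proof (HB k) as h2. rewrite sum_Sn in h1.
  change (Cmod (sum_n (t rho) k + t rho (S k))%C <= B) in h1.
  change (Cmod (sum_n (t rho) k : C) <= B) in h2.
  replace (t rho (S k)) with ((sum_n (t rho) k + t rho (S k)) + - sum_n (t rho) k)%C by ring.
  eapply Rle_trans; [apply Cmod_triangle|]. rewrite Cmod_opp. lra. }
assert (Hrho : 0 < rho) by (unfold rho; lra).
(* The tail is at most [4 * B * (Cmod z / rho) ^ 4]; [B + 1] keeps the constant positive when [B] is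
   0. *)
exists (4 * (B + 1) / rho ^ 4); split.
{ apply Rdiv_lt_0_compat; [lra|now apply pow_lt]. }
intros z Hz.
pose (q := Cmod z / rho).
assert (Hq : 0 <= q <= 1 / 2).
{ split; [apply Rdiv_le_0_compat; [apply Cmod_ge_0|assumption]|].
  apply Rmult_le_reg_r with rho; [assumption|]. unfold q, Rdiv; rewrite Rmult_assoc, Rinv_l by lra.
  unfold rho; lra. }
assert (zq : Cmod z = q * rho) by (unfold q; field; lra).
assert (half : forall m, q ^ m <= (1 / 2) ^ m) by (intros m; now apply pow_incr).
assert (q4 : 0 <= q ^ 4) by now apply pow_le.
(* The factor [1 - (1 / 2) ^ m] makes the induction exact: its increment matches the bound
   [2 * B * q ^ 4 * (1 / 2) ^ m] on the next term. *)
assert (part : forall m, Cmod (sum_n (t z) (3 + m) - sum_n (t z) 3)%C <= 4 * B * q ^ 4 * (1 - (1 / 2) ^ m)).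
{ induction m as [|m IH].
  - simpl Nat.add. replace (_ - _)%C with (0 : C) by (unfold Cminus; symmetry; apply Cplus_opp_r).
    rewrite Cmod_0; simpl; lra.
  - replace (3 + S m)%nat with (S (3 + m)) by lia. rewrite sum_Sn.
    change (Cmod (sum_n (t z) (3 + m) + t z (S (3 + m)) - sum_n (t z) 3)%C <= 4 * B * q ^ 4 * (1 - (1 / 2) ^ S m)).
    replace (sum_n (t z) (3 + m) + t z (S (3 + m)) - sum_n (t z) 3)%C
      with ((sum_n (t z) (3 + m) - sum_n (t z) 3) + t z (S (3 + m)))%C by ring.
    eapply Rle_trans; [apply Cmod_triangle|].
    assert (Cmod (t z (S (3 + m))) <= 2 * B * (q ^ 4 * (1 / 2) ^ m)).
    { rewrite tm, zq, Rpow_mult_distr.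
      replace (S (3 + m)) with (4 + m)%nat by lia. rewrite pow_add at 1.
      pose proof (coef (3 + m)%nat) as c1. replace (S (3 + m)) with (4 + m)%nat in c1 by lia.
      specialize (half m).
      assert (0 <= q ^ m) by (apply pow_le; lra).
      assert (0 <= q ^ 4 * q ^ m) by now apply Rmult_le_pos.
      assert (q ^ 4 * q ^ m <= q ^ 4 * (1 / 2) ^ m) by now apply Rmult_le_compat_l.
      rewrite Rmult_assoc.
      apply Rle_trans with (q ^ 4 * q ^ m * (2 * B)); [now apply Rmult_le_compat_l|]. nra. }
    simpl pow at 2. simpl pow in IH. simpl pow in H. simpl pow. lra. }
assert (S3 : sum_n (t z) 3 = (a 0%nat + a 1%nat * z + a 2%nat * (z * z) + a 3%nat * (z * z * z))%C).
{ rewrite !sum_Sn, sum_O.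
  change ((1 * a 0%nat + (z * 1) * a 1%nat + (z * (z * 1)) * a 2%nat + (z * (z * (z * 1))) * a 3%nat)%C
    = (a 0%nat + a 1%nat * z + a 2%nat * (z * z) + a 3%nat * (z * z * z))%C). ring. }
rewrite <- S3.
assert (Hz' : Cmod z < r) by lra.
apply le_epsilon; intros e He.
destruct (Hs z (D z Hz') (fun w => Cmod (w - f z)%C < e)) as [N HN].
{ apply (@locally_le_locally_norm _ C_NormedModule). exists (mkposreal _ He); intros w Hw; exact Hw. }
specialize (HN (3 + N)%nat ltac:(lia)). simpl in HN.
change (Cmod (sum_n (t z) (3 + N) - f z)%C < e) in HN.
specialize (part N).
replace (f z - sum_n (t z) 3)%C
  with ((sum_n (t z) (3 + N) - sum_n (t z) 3) + - (sum_n (t z) (3 + N) - f z))%C by ring.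
eapply Rle_trans; [apply Cmod_triangle|]. rewrite Cmod_opp.
replace (4 * (B + 1) / rho ^ 4 * Cmod z ^ 4) with (4 * (B + 1) * q ^ 4) by (unfold q; field; lra).
assert (0 <= (1 / 2) ^ N) by (apply pow_le; lra).
assert (0 <= 4 * B * q ^ 4 * (1 / 2) ^ N).
{ apply Rmult_le_pos; [apply Rmult_le_pos|]; lra. }
lra.
Qed.

(** One choice of [b n] must serve all tolerances, and a point of least modulus need not exist.
    Instead [b n] beats every threshold [1 / (k + 1)] with [k <= n] that some point of [T n]
    beats. *)
Lemma exists_null_sequence (T : nat -> C -> Prop) :
  (forall e, 0 < e -> exists N, forall n, (N <= n)%nat -> exists z, T n z /\ Cmod z < e) ->
  exists (n0 : nat) (b : nat -> C), (forall n, (n0 <= n)%nat -> T n (b n)) /\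
    filterlim b eventually (@locally C_UniformSpace (RtoC 0)).
Proof.
intros H.
assert (best : forall n m, (exists z, T n z) -> exists z, T n z /\
   forall k, (k <= m)%nat -> (exists z', T n z' /\ Cmod z' < / INR (S k)) -> Cmod z < / INR (S k)).
{ intros n m [z0 Hz0]; induction m as [|m [z [Hz IH]]].
  - destruct (classic (exists z', T n z' /\ Cmod z' < / INR 1)) as [[z' Hz']|Hn].
    + exists z'; split; [tauto|]. intros k Hk _. replace k with O by lia; tauto.
    + exists z0; split; [assumption|]. intros k Hk Hk'. replace k with O in Hk' by lia; tauto.
  - destruct (classic (exists z', T n z' /\ Cmod z' < / INR (S (S m)))) as [[z' [Hz' Hz'']]|Hn].
    + exists z'; split; [tauto|]. intros k Hk _. eapply Rlt_le_trans; [exact Hz''|].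
      apply Rinv_le_contravar; [apply lt_0_INR; lia|apply le_INR; lia].
    + exists z; split; [assumption|]. intros k Hk Hk'.
      destruct (Nat.eq_dec k (S m)) as [->|ne]; [tauto|]. apply IH; [lia|assumption]. }
destruct (H 1 Rlt_0_1) as [n0 Hn0].
assert (ch : forall n, exists z, (exists z', T n z') -> T n z /\
   forall k, (k <= n)%nat -> (exists z', T n z' /\ Cmod z' < / INR (S k)) -> Cmod z < / INR (S k)).
{ intros n; destruct (classic (exists z, T n z)) as [h|h].
  - destruct (best n n h) as [z Hz]; exists z; tauto.
  (* A placeholder for the indices with [T n] empty, all below [n0]. *)
  - exists (RtoC 0); tauto. }
pose (b := fun n => proj1_sig (constructive_indefinite_description _ (ch n))).
assert (Hb : forall n, (n0 <= n)%nat -> T n (b n) /\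
   forall k, (k <= n)%nat -> (exists z', T n z' /\ Cmod z' < / INR (S k)) -> Cmod (b n) < / INR (S k)).
{ intros n Hn; unfold b; destruct constructive_indefinite_description as [z Hz]; simpl.
  apply Hz. destruct (Hn0 n Hn) as [z' [h _]]; now exists z'. }
exists n0, b; split; [intros n Hn; now apply Hb|].
intros P [e He].
destruct (archimed_cor1 e (cond_pos e)) as [K [HK HK0]].
destruct (H (/ INR (S K))) as [N HN]; [apply Rinv_0_lt_compat, lt_0_INR; lia|].
exists (n0 + N + K)%nat; intros n Hn.
apply He, C_NormedModule_mixin_compat1.
change (Cmod (b n - 0)%C < e); replace (b n - 0)%C with (b n) by ring.
apply Rlt_trans with (/ INR (S K)).
- apply (proj2 (Hb n ltac:(lia))); [lia|]. apply HN; lia.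
- eapply Rlt_trans; [|exact HK]. apply Rinv_lt_contravar.
  + apply Rmult_lt_0_compat; apply lt_0_INR; lia.
  + apply lt_INR; lia.
Qed.

(** * Turning points of functions close to a cubic *)

(** On the vertical sides [al * x] dominates [W] because [(3 * be + K) * d < al]. On the horizontal
    sides the model [v] differs from [y] times the model [W] by [2 * be * d ^ 3] in absolute value;
    the errors of [v] and of [d * W] add up to [2 * K * d ^ 4], which is smaller because
    [K * d < be]. *)
Lemma perturbed_cubic_tangency (v W : R -> R -> R) (al be K d : R) :
  0 < d < 1 -> 0 < al -> 0 < be -> 0 <= K -> K * d < be -> (3 * be + K) * d < al ->
  (forall x y, - d <= x <= d -> - d <= y <= d ->
     continuity_2d_pt v x y /\ continuity_2d_pt W x y /\
     is_derive (fun t => v x t) y (W x y)) ->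
  (forall x y, - d <= x <= d -> - d <= y <= d ->
     Rabs (v x y - (al * x * y - be * (3 * x ^ 2 * y - y ^ 3))) <= K * d ^ 4 /\
     Rabs (W x y - (al * x - 3 * be * (x ^ 2 - y ^ 2))) <= K * d ^ 3) ->
  exists x y, - d <= x <= d /\ - d <= y <= d /\ v x y = 0 /\ W x y = 0.
Proof.
intros Hd Hal Hbe HK H1 H2 Hreg Happ.
assert (Hb : forall x y, - d <= x <= d -> - d <= y <= d ->
   - (K * d ^ 4) <= v x y - (al * x * y - be * (3 * x ^ 2 * y - y ^ 3)) <= K * d ^ 4 /\
   - (K * d ^ 3) <= W x y - (al * x - 3 * be * (x ^ 2 - y ^ 2)) <= K * d ^ 3).
{ intros x y Hx Hy; destruct (Happ x y Hx Hy) as [h1 h2]; split; now apply Rabs_le_between. }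
assert (Kd : 0 <= K * d) by nra.
assert (d2 : 0 < d ^ 2 < d) by (split; nra).
assert (d3 : 0 < d ^ 3) by (apply pow_lt; lra).
assert (Kd2 : K * d ^ 2 <= K * d) by nra.
assert (K3 : K * d ^ 3 <= K * d * d) by (replace (K * d ^ 3) with (K * d ^ 2 * d) by ring; nra).
assert (K4 : K * d ^ 4 < be * d ^ 3) by (replace (K * d ^ 4) with (K * d * d ^ 3) by ring; nra).
assert (bd : 3 * be * d + K * d < al) by lra.
assert (bd2 : 3 * be * d ^ 2 + K * d ^ 3 < al * d) by nra.
assert (bd3 : 3 * be * d ^ 3 < al * d ^ 2).
{ replace (3 * be * d ^ 3) with (3 * be * d * d ^ 2) by ring. apply Rmult_lt_compat_r; lra. }
apply (vertical_tangency v W d); try tauto; try lra.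
- destruct (Hb (- d) (- d) ltac:(lra) ltac:(lra)) as [h _]. nra.
- destruct (Hb (- d) d ltac:(lra) ltac:(lra)) as [h _]. nra.
- intros y Hy. destruct (Hb (- d) y ltac:(lra) ltac:(lra)) as [_ h].
  assert (0 <= be * (d ^ 2 - y ^ 2)) by (apply Rmult_le_pos; nra). nra.
- intros y Hy. destruct (Hb d y ltac:(lra) ltac:(lra)) as [_ h].
  assert (0 <= be * y ^ 2) by (apply Rmult_le_pos; [lra|apply pow2_ge_0]). nra.
- intros x Hx Hw. destruct (Hb x d ltac:(lra) ltac:(lra)) as [h1 h2].
  assert (L : al * x - 3 * be * x ^ 2 + 3 * be * d ^ 2 <= K * d ^ 3) by lra.
  apply Rmult_le_compat_l with (r := d) in L; [|lra].
  replace (d * (K * d ^ 3)) with (K * d ^ 4) in L by ring.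
  nra.
- intros x Hx Hw. destruct (Hb x (- d) ltac:(lra) ltac:(lra)) as [h1 h2].
  assert (L : al * x - 3 * be * x ^ 2 + 3 * be * d ^ 2 <= K * d ^ 3) by lra.
  apply Rmult_le_compat_l with (r := d) in L; [|lra].
  replace (d * (K * d ^ 3)) with (K * d ^ 4) in L by ring.
  nra.
Qed.

Lemma hol_at_is_derive_y (u v : R -> R -> R) (x y p q : R) :
  hol_at u v x y p q -> is_derive (fun t => v x t) y p.
Proof.
intros [_ H]. apply is_derive_Reals.
pose proof (derivable_pt_lim_comp_2d v (fun _ => x) id y q p 0 1 H
  (derivable_pt_lim_const x y) (derivable_pt_lim_id y)) as h.
replace (q * 0 + p * 1) with p in h by ring. exact h.
Qed.

(** Cauchy's estimate on discs of radius [d], applied to the difference with the cubic. Subtracting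
    the value at the centre doubles [E] and the estimate doubles it again, hence the 4. *)
Lemma cubic_close_derivative (u v W Z : R -> R -> R) (a0 a2 a3 d E : R) :
  0 < d ->
  (forall x y, - (2 * d) <= x <= 2 * d -> - (2 * d) <= y <= 2 * d ->
     hol_at u v x y (W x y) (Z x y) /\
     Rabs (u x y - (a0 + a2 * (x * x - y * y) + a3 * (x * x * x - 3 * (x * y * y)))) <= E /\
     Rabs (v x y - (a2 * (2 * (x * y)) + a3 * (3 * (x * x * y) - y * y * y))) <= E) ->
  forall x y, - d <= x <= d -> - d <= y <= d ->
    Rabs (W x y - (2 * a2 * x + 3 * a3 * (x * x - y * y))) <= 4 * E / d.
Proof.
intros Hd H x y Hx Hy.
assert (disk : forall a b, (a - x) ^ 2 + (b - y) ^ 2 <= d ^ 2 ->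
   - (2 * d) <= a <= 2 * d /\ - (2 * d) <= b <= 2 * d).
{ intros a b Hab. rewrite <- !Rsqr_pow2 in Hab.
  destruct (triangle_rectangle _ _ _ (Rlt_le _ _ Hd) Hab); lra. }
assert (dh := fun a b Ha Hb => hol_at_minus _ _ _ _ a b _ _ _ _
   (proj1 (H a b Ha Hb)) (hol_at_cubic a0 a2 a3 a b)).
replace (4 * E / d) with (2 * (2 * E) / d) by (field; lra).
eapply cauchy_estimate_re; [exact Hd| |exact (dh x y ltac:(lra) ltac:(lra))|].
- intros a b Hab; destruct (disk a b Hab) as [Ha Hb]; do 2 eexists; exact (dh a b Ha Hb).
- intros a b Hab; destruct (disk a b (Req_le _ _ Hab)) as [Ha Hb].
  destruct (H a b Ha Hb) as (_ & h1 & h2).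
  destruct (H x y ltac:(lra) ltac:(lra)) as (_ & h3 & h4).
  apply Rabs_le_between in h1, h2, h3, h4.
  split; apply Rabs_le; lra.
Qed.

Lemma turning_point_near_cubic (g : C -> C) (r a0 a2 a3 K d : R) :
  0 < d < 1 -> 4 * d < r -> 0 < a2 -> a3 < 0 -> 0 <= K ->
  4 * K * d < - a3 -> (- 3 * a3 + 4 * K) * d < 2 * a2 ->
  holomorphic_on (disc 0%C r) g ->
  (forall z, box (2 * d) z ->
     Cmod (g z - (a0 + a2 * (z * z) + a3 * (z * z * z)))%C <= K * d ^ 4) ->
  exists z, turning_point (disc 0%C r) g z /\ Cmod z <= 2 * d.
Proof.
intros Hd Hr H2 H3 HK HK1 HK2 Hg Happ.
assert (Cb : forall x y e, - e <= x <= e -> - e <= y <= e -> Cmod (x, y) <= 2 * e).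
{ intros x y e Hx Hy; eapply Rle_trans; [apply Cmod_le_2Rmax|].
  apply Rmult_le_compat_l; [lra|]. apply Rmax_lub; now apply Rabs_le. }
assert (D : forall x y, - (2 * d) <= x <= 2 * d -> - (2 * d) <= y <= 2 * d -> disc 0%C r (x, y)).
{ intros x y Hx Hy; apply disc_0.
  pose proof (Cb x y (2 * d) Hx Hy); lra. }
pose (u := fun x y => Re (g (x, y))). pose (v := fun x y => Im (g (x, y))).
pose (W := fun x y => Re (C_derive g (x, y))). pose (Z := fun x y => Im (C_derive g (x, y))).
assert (Hh : forall x y, - (2 * d) <= x <= 2 * d -> - (2 * d) <= y <= 2 * d ->
  hol_at u v x y (W x y) (Z x y)).
{ intros x y Hx Hy; apply is_derive_hol_at, C_derive_correct; [exact (RtoC 0)|].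
  apply Hg; auto. }
assert (Ha : forall x y, - (2 * d) <= x <= 2 * d -> - (2 * d) <= y <= 2 * d ->
  Rabs (u x y - (a0 + a2 * (x * x - y * y) + a3 * (x * x * x - 3 * (x * y * y)))) <= K * d ^ 4 /\
  Rabs (v x y - (a2 * (2 * (x * y)) + a3 * (3 * (x * x * y) - y * y * y))) <= K * d ^ 4).
{ intros x y Hx Hy. specialize (Happ (x, y) (conj Hx Hy)).
  destruct (Rabs_Re_Im_le_Cmod (g (x, y) - (a0 + a2 * ((x, y) * (x, y)) + a3 * ((x, y) * (x, y) * (x, y))))%C) as [b1 b2].
  split; (eapply Rle_trans; [|exact Happ]); [eapply Rle_trans; [|exact b1]|eapply Rle_trans; [|exact b2]];
  apply Req_le; f_equal; unfold u, v, Re, Im; simpl; ring. }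
assert (HW := cubic_close_derivative u v W Z a0 a2 a3 d (K * d ^ 4) (proj1 Hd)
  (fun x y Hx Hy => conj (Hh x y Hx Hy) (Ha x y Hx Hy))).
(* [4 * K] comes from the derivative: an error [K * d ^ 4] of the function becomes
   [4 * K * d ^ 3]. *)
destruct (perturbed_cubic_tangency v W (2 * a2) (- a3) (4 * K) d) as (x & y & Hx & Hy & hv & hw); try lra.
- intros x y Hx Hy.
  pose proof (Hh x y ltac:(lra) ltac:(lra)) as h.
  split; [|split].
  + eapply differentiable_pt_lim_continuity_2d, (proj2 h).
  + exact (hol_derivative_continuous u v W Z d (proj1 Hd) Hh x y Hx Hy).
  + exact (hol_at_is_derive_y _ _ _ _ _ _ h).
- intros x y Hx Hy; split.
  + destruct (Ha x y ltac:(lra) ltac:(lra)) as [_ h].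
    assert (0 <= K * d ^ 4) by (apply Rmult_le_pos; [lra|apply pow_le; lra]).
    replace (2 * a2 * x * y - - a3 * (3 * x ^ 2 * y - y ^ 3))
      with (a2 * (2 * (x * y)) + a3 * (3 * (x * x * y) - y * y * y)) by ring. lra.
  + specialize (HW x y Hx Hy).
    replace (4 * (K * d ^ 4) / d) with (4 * K * d ^ 3) in HW by (field; lra).
    replace (2 * a2 * x - 3 * - a3 * (x ^ 2 - y ^ 2))
      with (2 * a2 * x + 3 * a3 * (x * x - y * y)) by ring. exact HW.
- exists (x, y); split; [|now apply Cb].
  split; [apply D; lra|split; assumption].
Qed.

Theorem theorem9p16 (r : R) (r_pos : 0 < r)
    (f : C -> C) (a : nat -> C) (fn : nat -> C -> C)
    (f_hol : holomorphic_on (disc 0%C r) f)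
    (f_series : forall z : C, disc 0%C r z ->
       @is_pseries C_AbsRing C_NormedModule a z (f z))
    (a0_real : Im (a 0%nat) = 0) (a0_pos : 0 < Re (a 0%nat))
    (a1_zero : a 1%nat = 0%C)
    (a2_real : Im (a 2%nat) = 0) (a2_pos : 0 < Re (a 2%nat))
    (a3_real : Im (a 3%nat) = 0) (a3_neg : Re (a 3%nat) < 0)
    (fn_hol : forall n : nat, holomorphic_on (disc 0%C r) (fn n))
    (fn_cvg : cvg_unif_on_compacts (disc 0%C r) fn f) :
  exists (n0 : nat) (b : nat -> C),
    (forall n : nat, (n0 <= n)%nat -> turning_point (disc 0%C r) (fn n) (b n)) /\
    filterlim b eventually (@locally C_UniformSpace (RtoC 0)).
Proof.
assert (real : forall c : C, Im c = 0 -> c = RtoC (Re c)).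
{ intros [x y] h; unfold RtoC; simpl in *; now rewrite h. }
apply real in a0_real, a2_real, a3_real.
set (A0 := Re (a 0%nat)) in *; set (A2 := Re (a 2%nat)) in *; set (A3 := Re (a 3%nat)) in *.
destruct (pseries_cubic_remainder a f r r_pos f_series) as (M & HM & Hrem).
rewrite a0_real, a1_zero, a2_real, a3_real in Hrem.
apply (exists_null_sequence (fun n => turning_point (disc 0%C r) (fn n))); intros e He.
(* [257 = 4 ^ 4 + 1]: the Taylor remainder at [Cmod z <= 4 * d] contributes [256 * M * d ^ 4], and
   uniform convergence one more [M * d ^ 4]. *)
pose (K := 257 * M).
(* [16 * d <= r] puts [box (2 * d)], where [Cmod z <= 4 * d], inside the range [r / 4] of the
   remainder bound; [4 * d <= e] brings the turning point, of modulus at most [2 * d], within [e] of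
   0. *)
assert (small : exists d, 0 < d < 1 /\ 16 * d <= r /\ 4 * d <= e /\
   4 * K * d < - A3 /\ (- 3 * A3 + 4 * K) * d < 2 * A2).
{ assert (lim : forall p q, 0 <= p -> 0 < q -> forall d, 0 < d <= q / (p + 1) -> p * d < q).
  { intros p q Hp Hq d [h1 h2]. apply Rmult_le_compat_l with (r := p + 1) in h2; [|lra].
    replace ((p + 1) * (q / (p + 1))) with q in h2 by (field; lra). lra. }
  pose (d := Rmin (1 / 2) (Rmin (r / 16) (Rmin (e / 4)
     (Rmin (- A3 / (4 * K + 1)) (2 * A2 / (- 3 * A3 + 4 * K + 1)))))).
  assert (K0 : 0 < K) by (unfold K; lra).
  assert (d0 : 0 < d).
  { unfold d; repeat apply Rmin_glb_lt; try lra; apply Rdiv_lt_0_compat; lra. }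
  assert (d1 : d <= 1 / 2 /\ d <= r / 16 /\ d <= e / 4 /\ d <= - A3 / (4 * K + 1) /\
    d <= 2 * A2 / (- 3 * A3 + 4 * K + 1)).
  { repeat split; unfold d;
    repeat (first [apply Rmin_l | eapply Rle_trans; [apply Rmin_r|]]); apply Rle_refl. }
  exists d; repeat split; try lra; apply lim; lra. }
destruct small as (d & Hd & Hdr & Hde & HK1 & HK2).
assert (d4 : 0 < d ^ 4) by (apply pow_lt; lra).
assert (Cb : forall z, box (2 * d) z -> Cmod z <= 4 * d).
{ intros [x y] [Hx Hy]; simpl in Hx, Hy.
  eapply Rle_trans; [apply Cmod_le_2Rmax|].
  assert (Rmax (Rabs x) (Rabs y) <= 2 * d) by (apply Rmax_lub; apply Rabs_le; lra). lra. }
(* Only now that [d] is fixed is [N] chosen, with a tolerance of the order of the Taylor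
   remainder. *)
destruct (fn_cvg (box (2 * d)) (box_compact (2 * d) ltac:(lra))) with (eps := M * d ^ 4) as [N HN].
{ intros z Hz; apply disc_0; specialize (Cb z Hz); lra. }
{ now apply Rmult_lt_0_compat. }
exists N; intros n Hn.
destruct (turning_point_near_cubic (fn n) r A0 A2 A3 K d) as (z & Hz & Hz'); try lra; auto.
- unfold K; lra.
- intros z Hz. specialize (HN n Hn z Hz). specialize (Cb z Hz). specialize (Hrem z ltac:(lra)).
  assert (Cmod z ^ 4 <= (4 * d) ^ 4) by (apply pow_incr; split; [apply Cmod_ge_0|assumption]).
  assert (M * Cmod z ^ 4 <= 256 * M * d ^ 4).
  { replace (256 * M * d ^ 4) with (M * (4 * d) ^ 4) by ring. apply Rmult_le_compat_l; lra. }
  replace (fn n z - (A0 + A2 * (z * z) + A3 * (z * z * z)))%C with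
    ((fn n z - f z) + (f z - (A0 + 0 * z + A2 * (z * z) + A3 * (z * z * z))))%C by ring.
  eapply Rle_trans; [apply Cmod_triangle|]. unfold K; lra.
- exists z; split; [assumption|lra].
Qed.
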